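(* For integers $n\ge 4$ and $d$ with $n/2\le d\le n-2$, $$N_2(d,n;2)=2^{\binom n0+\binom n1+\cdots+\binom nd-1}+2^{2^{n-1}-1}.$$
   Context: For a prime power $q=p^m$ ($p$ prime) and integers $n>0$, $0\le d\le n(q-1)$, the $q$-ary Reed-Muller code is $$R_q(d,n)=\{f\in\mathbb F_q[X_1,\dots,X_n]:\deg f\le d,\ \deg_{X_j}f\le q-1 \text{ for } 1\le j\le n\},$$ where $\deg$ is the total degree and $\deg_{X_j}$ is the degree in $X_j$ (the zero polynomial is included). The weight of $f\in R_q(d,n)$ is $|f|=q^n-|Z(f)|$, where $Z(f)=\{\boldsymbol x\in\mathbb F_q^n:f(\boldsymbol x)=0\}$. For $t\ge 0$, $N_q(d,n;t)=|\{f\in R_q(d,n):\nu_p(|f|)\ge t\}|$, where $\nu_p$ is the $p$-adic valuation ($\nu_p(0)=\infty$); that is, the number of codewords with weight divisible by $p^t$. *)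

(* Defs.v *)
From HB Require Import structures.
From mathcomp Require Import all_boot all_order all_algebra.
From mathcomp Require Import mpoly.

Set Implicit Arguments.
Unset Strict Implicit.
Unset Printing Implicit Defensive.

Import GRing.Theory.
Local Open Scope ring_scope.

(* deg_{X_j} f, with value 0 for f = 0 *)
Definition degX (n : nat) (R : nzRingType) (j : 'I_n) (f : {mpoly R[n]}) : nat :=
  \max_(m <- msupp f) m j.

(* msize is one more than the total degree, and msize 0 = 0. *)
Definition in_RM (F : finFieldType) (d n : nat) (f : {mpoly F[n]}) : bool :=
  (msize f <= d.+1)%N && [forall j : 'I_n, (degX j f <= #|F| - 1)%N].

(* The code R_q(d, n), q = #|F|, as a subtype of the polynomials *)
Record RM (F : finFieldType) (d n : nat) : Type := MkRM {
  RM_poly :> {mpoly F[n]};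
  _ : in_RM d RM_poly
}.

Arguments RM : clear implicits.

HB.instance Definition _ F d n := [isSub for @RM_poly F d n].
HB.instance Definition _ F d n := [Choice of RM F d n by <:].

(* Codewords are determined by their coefficients on the monomials of degree
   at most d, whence RM F d n is finite. *)
Definition RM_coefs (F : finFieldType) d n (f : RM F d n) : {ffun 'X_{1..n < d.+1} -> F} :=
  [ffun m : 'X_{1..n < d.+1} => (RM_poly f)@_m].

Definition RM_of_coefs (F : finFieldType) d n (c : {ffun 'X_{1..n < d.+1} -> F}) :
    option (RM F d n) :=
  insub (\sum_(m : 'X_{1..n < d.+1}) c m *: 'X_[m]).

Lemma RM_coefsK F d n : pcancel (@RM_coefs F d n) (@RM_of_coefs F d n).
Proof.
move=> f; rewrite /RM_of_coefs.
under eq_bigr do rewrite ffunE.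
rewrite -mpolywE; first exact: valK.
by case/andP: (valP f).
Qed.

HB.instance Definition _ F d n :=
  PCanIsCountable (@RM_coefsK F d n).
HB.instance Definition _ F d n : isFinite (RM F d n) :=
  PCanIsFinite (@RM_coefsK F d n).

Definition zeros (F : finFieldType) (n : nat) (f : {mpoly F[n]}) :
    {set {ffun 'I_n -> F}} :=
  [set x : {ffun 'I_n -> F} | f.@[x] == 0].

Definition weight (F : finFieldType) (n : nat) (f : {mpoly F[n]}) : nat :=
  (#|F| ^ n - #|zeros f|)%N.

(* N_q(d, n; t). The characteristic p of F is the only prime divisor of #|F|.
   Divisibility by p ^ t, unlike t <= logn p _, holds for weight 0. *)
Definition Nq (F : finFieldType) (d n t : nat) : nat :=
  #|[set f : RM F d n | (pdiv #|F| ^ t %| weight f)%N]|.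

(* Main.v *)
Require Import Defs.
From mathcomp Require Import all_boot all_order all_algebra.
From mathcomp Require Import mpoly zify.

(** A binary codeword of degree at most [d] is a sum of distinct squarefree
    monomials X^A, where A is a subset of the n variables with |A| <= d, so it
    is a set S of such subsets.  Its value at the indicator of X is the parity
    of the number of B in S with B included in X.

    Adding a monomial X^A to S changes the weight by
    wt(X^A) - 2 wt(S X^A), where wt(X^A) = 2^(n-|A|) is divisible by 4 because
    |A| <= n - 2, and where wt(S X^A) has the parity of the coefficient of the
    full monomial in S X^A, that is, of the number of B in S with
    A :|: B = setT.  All weights are even, since the full monomial has degree
    n > d; hence divisibility by 4 changes exactly when this number is odd
    ([dvdn4_anf_weight_setU1]).

    Let U be the family of the sets of size below n/2, together with the sets
    of size n/2 that contain a fixed point.  It contains exactly one of each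
    complementary pair, so it has 2^(n-1) members, and no two members cover
    the ground set; as n <= 2d, all its members are monomials of the code.

    If S is included in U, then S is built up by additions that all preserve
    divisibility by 4, so its weight is divisible by 4
    ([dvdn4_anf_weight_sub]).  If not, choose an inclusion-maximal B in S
    outside U and let A be its complement, which is in U.  The members of S
    that cover the ground set together with A are those that include B; they
    are outside U, and so B is the only one.  Hence toggling A in S changes
    divisibility by 4 ([toggle_dvdn4]).  Since A is in U, this toggling does
    not affect the choice of B and is an involution, so exactly half of the
    codewords not supported in U have weight divisible by 4.  With W the set
    of all monomials of the code, the number Z of codewords looked for
    satisfies Z = 2^|U| + (2^|W| - 2^|U|) / 2 ([card_dvdn4_anf_weight]). *)

Set Implicit Arguments.
Unset Strict Implicit.
Unset Printing Implicit Defensive.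

(** * Weights of squarefree polynomials modulo 4 *)

Section Combinatorics.
Variable T : finType.
Implicit Types (A B X : {set T}) (S U W : {set {set T}}).

(** The number of monomials of S that take the value 1 at the indicator of X. *)
Definition nb_below S X : nat := #|[set B in S | B \subset X]|.
Definition anf_weight S : nat := #|[set X : {set T} | odd (nb_below S X)]|.
(** The weight of the product of S with the monomial X^A. *)
Definition above_weight A S : nat :=
  #|[set X : {set T} | (A \subset X) && odd (nb_below S X)]|.

Lemma card_supersets A : #|[set X : {set T} | A \subset X]| = 2 ^ #|~: A|.
Proof.
rewrite -card_powerset -(card_imset _ (@setC_inj T)).
congr #|pred_of_set _|; apply/setP=> X.
by rewrite -{1}[X]setCK (mem_imset _ _ (@setC_inj T)) powersetE inE subsetC.
Qed.

(** Modulo 2 the weight of S X^A is the sum of the weights of its monomials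
    X^(A :|: B), which are the powers 2^(n - |A :|: B|): only the full monomial
    contributes. *)
Lemma odd_above_weight A S :
  odd (above_weight A S) = odd #|[set B in S | A :|: B == setT]|.
Proof.
have cnt (P : {pred {set T}}) : #|[set B in S | P B]| = \sum_(B in S) P B.
  by rewrite -sum1dep_card big_mkcondr; apply: eq_bigr => B _; case: (P B).
have -> : odd (above_weight A S) =
    odd (\sum_(X : {set T} | A \subset X) \sum_(B in S) (B \subset X)).
  rewrite /above_weight -sum1dep_card big_mkcondr /=.
  rewrite !(big_morph odd oddD (erefl : odd 0 = false)).
  apply: eq_bigr => X _; rewrite -(cnt (fun B => B \subset X)).
  by rewrite -/(nb_below S X); case: (odd (nb_below S X)).
rewrite exchange_big /= cnt !(big_morph odd oddD (erefl : odd 0 = false)).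
apply: eq_bigr => B _.
have -> : \sum_(X : {set T} | A \subset X) (B \subset X) = 2 ^ #|~: (A :|: B)|.
  rewrite -card_supersets -sum1dep_card [RHS](eq_bigl _ _ (fun X => subUset X A B)).
  by rewrite big_mkcondr; apply: eq_bigr => X _; case: (B \subset X).
rewrite oddX orbF cards_eq0 -setCT (inj_eq (@setC_inj T)).
by case: (_ == _).
Qed.

Lemma odd_anf_weight S : odd (anf_weight S) = (setT \in S).
Proof.
have -> : anf_weight S = above_weight set0 S.
  by congr #|pred_of_set _|; apply/setP=> X; rewrite !inE sub0set.
rewrite odd_above_weight.
have -> : [set B in S | set0 :|: B == setT] = S :&: [set setT].
  by apply/setP=> B; rewrite !inE set0U.
case: (boolP (setT \in S)) => TS.
  by rewrite (setIidPr _) ?sub1set // cards1.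
have /eqP -> : S :&: [set setT] == set0; last by rewrite cards0.
by rewrite setI_eq0 disjoint_sym disjoints1.
Qed.

(** The identity |P xor Q| + 2 |P and Q| = |P| + |Q|, applied to the supports
    of S and of X^A. *)
Lemma anf_weight_setU1 A S : A \notin S ->
  anf_weight (A |: S) + 2 * above_weight A S = anf_weight S + 2 ^ #|~: A|.
Proof.
move=> nAS; rewrite -card_supersets /anf_weight /above_weight -!sum1dep_card.
rewrite big_mkcond [X in _ + 2 * X]big_mkcond [X in _ = X + _]big_mkcond.
rewrite [X in _ = _ + X]big_mkcond /= big_distrr /= -!big_split /=.
apply: eq_bigr => X _.
have -> : nb_below (A |: S) X = (A \subset X) + nb_below S X.
  rewrite /nb_below; case: (boolP (A \subset X)) => AX /=.
    have nA : A \notin [set B in S | B \subset X] by rewrite inE (negPf nAS).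
    transitivity #|A |: [set B in S | B \subset X]|; last by rewrite cardsU1 nA.
    congr #|pred_of_set _|.
    by apply/setP=> B; rewrite !inE; case: eqP => // ->.
  rewrite add0n; congr #|pred_of_set _|.
  by apply/setP=> B; rewrite !inE; case: eqP => // ->; rewrite (negPf AX) !andbF.
by case: (A \subset X) => //=; case: (odd (nb_below S X)).
Qed.

Lemma dvdn4_anf_weight_setU1 A S :
    A \notin S -> setT \notin S -> 1 < #|~: A| ->
  (4 %| anf_weight (A |: S)) =
    (4 %| anf_weight S) (+) odd #|[set B in S | A :|: B == setT]|.
Proof.
move=> nAS nTS lA; have e := anf_weight_setU1 nAS.
have ev := odd_anf_weight S; rewrite (negPf nTS) in ev.
rewrite -odd_above_weight.
have [k ek] : exists k, 2 ^ #|~: A| = 4 * k.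
  by exists (2 ^ (#|~: A| - 2)); rewrite -[4]/(2 ^ 2) -expnD subnKC.
by move: e ev; rewrite ek; lia.
Qed.

(** * Counting by an involution *)

Section Counting.
Variables U W : {set {set T}}.
Hypothesis U_compl : forall A, (~: A \in U) = (A \notin U).
Hypothesis U_noncover : {in U &, forall A B, A :|: B != setT}.
Hypothesis sUW : U \subset W.
Hypothesis W_small : {in W, forall A, 1 < #|~: A|}.

Let nTW S : S \subset W -> setT \notin S.
Proof.
move=> /subsetP sSW; apply/negP=> /sSW /W_small.
by rewrite setCT cards0.
Qed.

Lemma dvdn4_anf_weight_sub S : S \subset U -> 4 %| anf_weight S.
Proof.
elim: {S}#|S| {-2}S (erefl #|S|) => [|k IH] S cS sSU.
  have -> : S = set0 by apply/eqP; rewrite -cards_eq0 cS.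
  rewrite /anf_weight (_ : [set X : {set T} | _] = set0) ?cards0 //.
  apply/setP=> X; rewrite !inE /nb_below (_ : [set B in _ | _] = set0) ?cards0 //.
  by apply/setP=> B; rewrite !inE.
have /card_gt0P [A AS] : 0 < #|S| by rewrite cS.
have AU := subsetP sSU _ AS.
have sS'U : S :\ A \subset U := subset_trans (subsetDl _ _) sSU.
rewrite -(setD1K AS) dvdn4_anf_weight_setU1.
- rewrite IH //; last by move: cS; rewrite (cardsD1 A) AS => -[].
  rewrite (_ : [set B in _ | _] = set0) ?cards0 //.
  apply/setP=> B; rewrite [in RHS]inE; apply/negbTE/negP; rewrite inE.
  by case/andP=> /(subsetP sS'U) BU; apply/negP/U_noncover.
- by rewrite setD11.
- exact/nTW/(subset_trans sS'U).
- exact/W_small/(subsetP sUW).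
Qed.

(** The choice depends on S only through [S :\: U], which is what makes
    [toggle] an involution. *)
Definition pivot S : {set T} :=
  odflt set0 [pick B in S :\: U |
    [forall B' in S :\: U, (B \subset B') ==> (B' == B)]].

Lemma pivotP S : ~~ (S \subset U) ->
  pivot S \in S :\: U /\
  {in S :\: U, forall B, pivot S \subset B -> B = pivot S}.
Proof.
move=> nSU; rewrite /pivot; case: pickP => [B /andP[BS /forallP h] | none] /=.
  by split=> // B' B'S sBB'; apply/eqP; move: (h B'); rewrite B'S sBB'.
have [B0 B0S] : exists B, B \in S :\: U.
  by apply/set0Pn; rewrite setD_eq0.
have [B BS hB] := arg_maxnP (fun B : {set T} => #|B|) B0S.
have {}BS : B \in S :\: U := BS.
case/negP: (negbT (none B)); rewrite BS; apply/forall_inP=> B' B'S.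
by apply/implyP=> sBB'; rewrite eq_sym eqEcard sBB'; apply: hB.
Qed.

Definition toggle S : {set {set T}} :=
  let A := ~: pivot S in if A \in S then S :\ A else A |: S.

Lemma pivot_compl S : ~~ (S \subset U) -> ~: pivot S \in U.
Proof. by case/pivotP; rewrite U_compl inE => /andP[]. Qed.

Lemma toggle_setD S : ~~ (S \subset U) -> toggle S :\: U = S :\: U.
Proof.
move/pivot_compl=> AU; apply/setP=> B; rewrite /toggle.
by case: ifP => _; rewrite !inE; case: eqP => [->|//]; rewrite AU.
Qed.

Lemma pivot_toggle S : ~~ (S \subset U) -> pivot (toggle S) = pivot S.
Proof. by move=> h; rewrite /pivot toggle_setD. Qed.

Lemma toggleK S : ~~ (S \subset U) -> toggle (toggle S) = S.
Proof.
move=> h; rewrite {1}/toggle pivot_toggle // /toggle.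
case: (boolP (~: pivot S \in S)) => AS; first by rewrite setD11 setD1K.
by rewrite setU11 setU1K.
Qed.

(** The only member of S that covers the ground set together with the
    complement of the pivot B is B itself: such a member includes B and lies
    outside U because [~: B] is in U, so it equals B by maximality. *)
Lemma toggle_dvdn4 S : S \subset W -> ~~ (S \subset U) ->
  (4 %| anf_weight (toggle S)) = ~~ (4 %| anf_weight S).
Proof.
move=> sSW nSU; have AU := pivot_compl nSU.
have [] := pivotP nSU; rewrite /toggle inE => /andP[nBU BS] Bmax.
move: AU Bmax; set B := pivot S in nBU BS * => AU Bmax.
(* Comparing S without [~: B] to S with it covers both directions of the toggle. *)
have key : (4 %| anf_weight (~: B |: (S :\ ~: B))) =
           ~~ (4 %| anf_weight (S :\ ~: B)).
  rewrite dvdn4_anf_weight_setU1 ?setD11 //; last 2 first.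
  - exact/nTW/(subset_trans (subsetDl _ _)).
  - exact/W_small/(subsetP sUW).
  rewrite (_ : [set _ in _ | _] = [set B]) ?cards1 ?addbT //.
  have coverE B' : (~: B :|: B' == setT) = (B \subset B').
    by rewrite -subTset -{2}[B]setCK -setD_eq0 setTD setCU setCK -setDE setD_eq0.
  apply/setP=> B'; rewrite !inE coverE; apply/idP/eqP=> [|->].
    case/andP=> /andP[_ B'S] sBB'; apply: Bmax => //; rewrite inE B'S andbT.
    apply/negP=> B'U; have := U_noncover AU B'U.
    by rewrite coverE sBB'.
  by rewrite BS subxx !andbT; apply: contraNneq nBU => ->.
case: ifPn => AS; first by move: key; rewrite setD1K // => ->; rewrite negbK.
suff e : S :\ ~: B = S by move: key; rewrite e.
by apply/setDidPl; rewrite disjoint_sym disjoints1.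
Qed.

Lemma toggle_sub S : S \subset W -> ~~ (S \subset U) -> toggle S \subset W.
Proof.
move=> sSW nSU; rewrite /toggle; case: ifP => _.
  exact: subset_trans (subsetDl _ _) sSW.
by rewrite subUset sub1set sSW andbT (subsetP sUW) // pivot_compl.
Qed.

Lemma toggle_nsub S : ~~ (S \subset U) -> ~~ (toggle S \subset U).
Proof. by move=> h; rewrite -setD_eq0 toggle_setD // setD_eq0. Qed.

Theorem card_dvdn4_anf_weight :
  2 * #|[set S : {set {set T}} | (S \subset W) && (4 %| anf_weight S)]| =
    2 ^ #|W| + 2 ^ #|U|.
Proof.
set Z := [set S : {set {set T}} | _].
set N := powerset W :\: powerset U.
set G := [set S in N | 4 %| anf_weight S].
set D := [set S in N | ~~ (4 %| anf_weight S)].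
have NP S : S \in N -> S \subset W /\ ~~ (S \subset U).
  by rewrite !inE => /andP[].
have toggleN S : S \in N -> toggle S \in N.
  by case/NP=> sSW nSU; rewrite !inE toggle_nsub ?toggle_sub.
(* G and D are the codewords outside U with weight divisible, respectively not
   divisible, by 4; toggling exchanges them. *)
have eD : D = toggle @: G.
  apply/setP=> S; rewrite inE; apply/andP/imsetP=> [[SN nS4]|[S' + ->]].
    have [sSW nSU] := NP S SN.
    by exists (toggle S); rewrite ?toggleK // inE toggleN ?toggle_dvdn4.
  rewrite inE => /andP[S'N S'4]; have [sSW nSU] := NP S' S'N.
  by rewrite toggleN ?toggle_dvdn4 // negbK.
have cGD : #|D| = #|G|.
  rewrite eD card_in_imset // => S S'; rewrite !inE -!andbA.
  move=> /and3P[nSU _ _] /and3P[nS'U _ _] e.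
  by rewrite -(toggleK nSU) e toggleK.
have cN : #|N| = #|G| + #|D|.
  rewrite -(cardsID [set S : {set {set T}} | 4 %| anf_weight S] N); congr (_ + _);
  by congr #|pred_of_set _|; apply/setP=> S; rewrite !inE andbC.
have cZ : #|Z| = #|powerset U| + #|G|.
  rewrite -(cardsID (powerset U) Z); congr (_ + _);
    congr #|pred_of_set _|; apply/setP=> S; rewrite !inE; last by rewrite andbA.
  case: (boolP (S \subset U)) => sSU; rewrite ?andbF // andbT.
  by rewrite (subset_trans sSU sUW) dvdn4_anf_weight_sub.
have cP : #|powerset W| = #|powerset U| + #|N|.
  rewrite -(cardsID (powerset U) (powerset W)); congr (_ + _).
  by rewrite (setIidPr _) ?powersetS.
move: cN cZ cP; rewrite cGD !card_powerset; lia.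
Qed.
End Counting.
End Combinatorics.

(** * Reed-Muller codewords as sets of monomials *)

Section Polynomials.
Import GRing.Theory.
Local Open Scope ring_scope.

Lemma F2_eq_natr (a : 'F_2) : a = (a != 0)%:R.
Proof. by case: a => [[|[|//]]] h; apply/val_inj. Qed.

Lemma natr_F2_eq0 k : (k%:R == 0 :> 'F_2) = ~~ odd k.
Proof.
by rewrite -(dvdn_pcharf (pchar_Fp (isT : prime 2))) dvdn2.
Qed.

Variable n : nat.
Implicit Types (f : {mpoly 'F_2[n]}) (S : {set {set 'I_n}}).

Definition anf_of f : {set {set 'I_n}} := [set A | f@_(mesym1 A) != 0].
Definition poly_of S : {mpoly 'F_2[n]} := \sum_(A in S) 'X_[mesym1 A].

Lemma mcoeff_poly_of S (m : 'X_{1..n}) :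
  (poly_of S)@_m = [exists A in S, m == mesym1 A]%:R.
Proof.
rewrite raddf_sum /=; under eq_bigr => A _ do rewrite mcoeffX.
case: (boolP [exists _ in _, _]) => [/exists_inP[A AS /eqP ->]|].
  rewrite (bigD1 A) //= eqxx big1 ?addr0 // => B /andP[_ /negPf nBA].
  by rewrite (inj_eq (@inj_mesym1 n)) nBA.
move/exists_inPn=> h; rewrite big1 // => A /h.
by rewrite eq_sym => /negPf ->.
Qed.

Lemma poly_ofK : cancel poly_of anf_of.
Proof.
move=> S; apply/setP=> A; rewrite inE mcoeff_poly_of.
have -> : [exists B in S, mesym1 A == mesym1 B] = (A \in S).
  apply/exists_inP/idP => [[B BS /eqP/inj_mesym1 -> //]|AS].
  by exists A.
by case: (A \in S).
Qed.

(** Over a field with two elements every individual degree is at most 1, so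
    each monomial is the product of the variables in a set A. *)
Lemma in_RM_F2 d f :
  in_RM d f <-> {in msupp f, forall m : 'X_{1..n}, exists2 A : {set 'I_n},
    m = mesym1 A & (#|A| <= d)%N}.
Proof.
rewrite /in_RM msizeE /degX card_Fp //; split=> [/andP[/bigmax_leqP_seq hd /forallP hj]|h].
  move=> m mf; have dm : (mdeg m <= d)%N by apply: hd.
  have : mechar (mdeg m) m.
    rewrite /mechar eqxx; apply/forallP=> j.
    by have /bigmax_leqP_seq hm := hj j; exact: (hm m mf).
  rewrite mecharP => /existsP[A /andP[/eqP em /eqP cA]].
  by exists A; rewrite ?cA.
apply/andP; split.
  by apply/bigmax_leqP_seq=> m /h[A -> cA] _; rewrite mdeg_mesym1.
apply/forallP=> j; apply/bigmax_leqP_seq=> m /h[A -> _] _.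
by rewrite mnmE; case: (_ \in _).
Qed.

Lemma poly_of_in_RM d S :
  S \subset [set A : {set 'I_n} | (#|A| <= d)%N] -> in_RM d (poly_of S).
Proof.
move/subsetP=> sSd; apply/in_RM_F2 => m; rewrite mcoeff_msupp mcoeff_poly_of.
case: exists_inP => // -[A AS /eqP ->] _; exists A => //.
by have := sSd A AS; rewrite inE.
Qed.

Lemma anf_ofK d f : in_RM d f -> poly_of (anf_of f) = f.
Proof.
move/in_RM_F2=> h; apply/mpolyP=> m; rewrite mcoeff_poly_of [RHS]F2_eq_natr.
congr (_ : bool)%:R; apply/exists_inP/idP=> [[A + /eqP ->]|]; first by rewrite inE.
rewrite -mcoeff_msupp => mf; have [A em _] := h m mf.
by exists A; rewrite ?inE -?em -?mcoeff_msupp.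
Qed.

Lemma anf_of_sub d f :
  in_RM d f -> anf_of f \subset [set A : {set 'I_n} | (#|A| <= d)%N].
Proof.
move/in_RM_F2=> h; apply/subsetP=> A; rewrite !inE -mcoeff_msupp.
by case/h=> B /inj_mesym1 ->.
Qed.

Definition one_set (x : {ffun 'I_n -> 'F_2}) : {set 'I_n} :=
  [set i | x i != 0].

Lemma one_set_inj : injective one_set.
Proof.
move=> x y /setP e; apply/ffunP=> i; rewrite [x i]F2_eq_natr [y i]F2_eq_natr.
by move: (e i); rewrite !inE => ->.
Qed.

Lemma meval_poly_of S (x : {ffun 'I_n -> 'F_2}) :
  (poly_of S).@[x] = (nb_below S (one_set x))%:R.
Proof.
rewrite raddf_sum /= /nb_below -sum1dep_card big_mkcondr natr_sum /=.
apply: eq_bigr => A _; rewrite mevalX.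
case: (boolP (A \subset one_set x)) => [/subsetP sA|/subsetPn[i iA]].
  rewrite big1 // => i _; rewrite mnmE [x i]F2_eq_natr.
  case: (boolP (i \in A)) => [/sA|_]; last by rewrite expr0.
  by rewrite inE => ->; rewrite expr1n.
rewrite inE negbK => /eqP xi; rewrite (bigD1 i) //= mnmE iA xi expr1.
by rewrite mul0r.
Qed.

Lemma weight_poly_of S : weight (poly_of S) = anf_weight S.
Proof.
have cV : #|{ffun 'I_n -> 'F_2}| = (2 ^ n)%N by rewrite card_ffun card_Fp ?card_ord.
rewrite /weight card_Fp // -cV -(cardsC (zeros (poly_of S))) addKn.
rewrite -(card_imset _ one_set_inj) /anf_weight.
congr #|pred_of_set _|; apply/setP=> X; rewrite inE.
have [x ->] : exists x, X = one_set x.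
  exists [ffun i => (i \in X)%:R]; apply/setP=> i; rewrite inE ffunE.
  by case: (i \in X).
by rewrite (mem_imset _ _ one_set_inj) !inE meval_poly_of natr_F2_eq0 negbK.
Qed.

Lemma Nq_F2_eq d t :
  Nq 'F_2 d n t = #|[set S : {set {set 'I_n}} |
    (S \subset [set A : {set 'I_n} | #|A| <= d]) && (2 ^ t %| anf_weight S)]|%N.
Proof.
have inj : injective (fun f : RM 'F_2 d n => anf_of f).
  by move=> f g e; apply: val_inj; rewrite /= -(anf_ofK (valP f)) e (anf_ofK (valP g)).
rewrite /Nq card_Fp // -(card_imset _ inj).
congr #|pred_of_set _|; apply/setP=> S; rewrite !inE; apply/imsetP/andP.
  case=> f; rewrite inE => wf ->; split; first exact: (anf_of_sub (valP f)).
  by rewrite -weight_poly_of (anf_ofK (valP f)).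
case=> sS wS; exists (MkRM (poly_of_in_RM sS)); last by rewrite /= poly_ofK.
by rewrite inE /= weight_poly_of.
Qed.
End Polynomials.

(** * Half of the power set without covering pairs *)

Section SmallHalf.
Variables (n : nat) (i0 : 'I_n).

(** The point [i0] breaks the tie between complementary sets of size n/2; any two
    sets of size n/2 that contain it overlap, hence do not cover. *)
Definition small_half : {set {set 'I_n}} :=
  [set A : {set 'I_n} | (2 * #|A| < n) || (2 * #|A| == n) && (i0 \in A)].

Lemma small_half_setC (A : {set 'I_n}) :
  (~: A \in small_half) = (A \notin small_half).
Proof.
have := cardsC A; rewrite card_ord !inE.
by case: (i0 \in A); lia.
Qed.

Lemma small_half_noncover : {in small_half &, forall A B, A :|: B != setT}.
Proof.
move=> A B; rewrite !inE => hA hB; apply/eqP=> e.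
have := cardsUI A B; rewrite e cardsT card_ord.
case/orP: hA => [?|/andP[? Ai]]; case/orP: hB => [?|/andP[? Bi]]; try lia.
have : 0 < #|A :&: B| by apply/card_gt0P; exists i0; rewrite inE Ai.
lia.
Qed.

Lemma card_small_half : #|small_half| = 2 ^ (n - 1).
Proof.
have cC : #|~: small_half| = #|small_half|.
  rewrite -[RHS](card_imset _ (@setC_inj _)); congr #|pred_of_set _|.
  apply/setP=> A; rewrite inE -{2}[A]setCK (mem_imset _ _ (@setC_inj _)).
  by rewrite small_half_setC.
have := cardsC small_half; rewrite cC -cardsT -powersetT card_powerset cardsT card_ord.
have n0 : 0 < n := leq_ltn_trans (leq0n _) (ltn_ord i0).
have -> : 2 ^ n = 2 * 2 ^ (n - 1) by rewrite -expnS subn1 prednK.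
lia.
Qed.
End SmallHalf.

(** * The number of codewords *)

Lemma card_subsets_leq (T : finType) d :
  #|[set A : {set T} | #|A| <= d]| = \sum_(0 <= i < d.+1) 'C(#|T|, i).
Proof.
elim: d => [|d IH].
  rewrite big_nat1 -card_draws; congr #|pred_of_set _|.
  by apply/setP=> A; rewrite !inE leqn0.
rewrite big_nat_recr //= -IH -card_draws.
rewrite -(cardsID [set A : {set T} | #|A| <= d] [set A : {set T} | #|A| <= d.+1]).
congr (_ + _);
  congr #|pred_of_set _|; apply/setP=> A; rewrite !inE; lia.
Qed.

Theorem corollary3p4 (n d : nat) (hn : (4 <= n)%N)
    (hd1 : (n <= 2 * d)%N) (hd2 : (d <= n - 2)%N) :
  Nq 'F_2 d n 2
    = (2 ^ ((\sum_(0 <= i < d.+1) 'C(n, i)) - 1) + 2 ^ (2 ^ (n - 1) - 1))%N.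
Proof.
have n0 : 0 < n by lia.
pose i0 := Ordinal n0; rewrite Nq_F2_eq.
set W := [set A : {set 'I_n} | _].
have sUW : small_half i0 \subset W by apply/subsetP=> A; rewrite !inE; lia.
have W_small : {in W, forall A : {set 'I_n}, 1 < #|~: A|}.
  by move=> A; have := cardsC A; rewrite card_ord inE; lia.
have cZ := card_dvdn4_anf_weight (@small_half_setC _ i0)
  (@small_half_noncover _ i0) sUW W_small.
have cU := card_small_half i0.
have cW : #|W| = \sum_(0 <= i < d.+1) 'C(n, i).
  by rewrite card_subsets_leq card_ord.
have U0 : 0 < #|small_half i0| by rewrite cU expn_gt0.
have W0 : 0 < #|W| := leq_trans U0 (subset_leq_card sUW).
(* Doubling both sides absorbs the two exponents decreased by 1, which are
   positive. *)
rewrite -cU -cW; apply/eqP; rewrite -(eqn_pmul2l (isT : 0 < 2)) cZ mulnDr.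
by rewrite -!expnS !subn1 !prednK.
Qed.
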